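(* Let $k$ be a field with $\operatorname{char}(k)>0$ and let $n\ge 2$ be an integer. Then $c_n(k)$ is infinite.
   Context: For a field $k$ and a positive integer $n$, the Cremona group $\operatorname{Cr}_n(k)$ is the group of birational automorphisms of $\mathbb{P}^n_k$ over $k$; equivalently, the group of $k$-algebra automorphisms of the purely transcendental field extension $k(x_1,\ldots,x_n)/k$. For a finite group $G$, the representation dimension $\operatorname{rdim}_k(G)$ is the minimal $N$ such that there is an injective group homomorphism $G \hookrightarrow \operatorname{GL}_N(k)$. Define \[ c_n(k) := \sup\{\operatorname{rdim}_k(G) \mid G \text{ a finite group with } G \subseteq \operatorname{Cr}_n(k)\}. \] *)

(* Defs.v *)
From HB Require Import structures.
From mathcomp Require Import all_boot all_order all_algebra all_fingroup.
From mathcomp Require Import mxrepresentation.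
From mathcomp Require Import mpoly.
From mathcomp Require Import boolp classical_sets reals constructive_ereal ereal.

Set Implicit Arguments.
Unset Strict Implicit.
Unset Printing Implicit Defensive.

Import GRing.Theory.
Local Open Scope ring_scope.

Definition ratfun (k : fieldType) (n : nat) : fieldType :=
  {fraction {mpoly k[n]}}.

Definition ratconst (k : fieldType) (n : nat) (c : k) : ratfun k n :=
  tofrac c%:MP_[n].

(* The Cremona group, as the group of k-algebra automorphisms of
   k(x_1, ..., x_n). *)
Record cremona (k : fieldType) (n : nat) := Cremona {
  cremona_map :> {rmorphism ratfun k n -> ratfun k n};
  cremona_bij : bijective cremona_map;
  cremona_const : forall c : k, cremona_map (ratconst n c) = ratconst n c
}.

Section CremonaGroup.
Variables (k : fieldType) (n : nat).
Implicit Types f g h : cremona k n.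

Lemma cremona_ext f g : f =1 g -> f = g.
Proof.
case: f g => [f fb fc] [g gb gc] /= /funext fg.
have {fg} fg : f = g.
  case: f g fg {fb fc gb gc} => [f [[f1] [f2]]] [g [[g1] [g2]]] /= fg.
  by case: _ / fg in g1 g2 *; congr GRing.RMorphism.Pack;
    rewrite (Prop_irrelevance f1 g1) (Prop_irrelevance f2 g2).
case: _ / fg in gb gc *.
by rewrite (Prop_irrelevance fb gb) (Prop_irrelevance fc gc).
Qed.

Definition cremona_one : cremona k n.
Proof.
exists (idfun : {rmorphism ratfun k n -> ratfun k n}) => //.
by exists id.
Defined.

Definition cremona_mul f g : cremona k n.
Proof.
exists (f \o g : {rmorphism ratfun k n -> ratfun k n}) => [|c /=].
  exact: bij_comp (cremona_bij f) (cremona_bij g).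
by rewrite !cremona_const.
Defined.

Lemma cremona_inv_subproof f :
  exists h, cancel f h /\ cancel h f.
Proof.
have [f' fK f'K] := cremona_bij f.
have f'a : zmod_morphism f' by move=> x y; apply: (can_inj fK); rewrite f'K rmorphB !f'K.
have f'm : monoid_morphism f'.
  split; first by apply: (can_inj fK); rewrite f'K rmorph1.
  by move=> x y; apply: (can_inj fK); rewrite f'K rmorphM !f'K.
pose F : {rmorphism ratfun k n -> ratfun k n} :=
  HB.pack f' (GRing.isZmodMorphism.Build _ _ f' f'a)
    (GRing.isMonoidMorphism.Build _ _ f' f'm).
have Fb : bijective F by exists f.
have Fc c : F (ratconst n c) = ratconst n c.
  by apply: (can_inj fK); rewrite /= f'K cremona_const.
by exists (Cremona Fb Fc).
Qed.

Definition cremona_inv f : cremona k n :=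
  sval (cid (cremona_inv_subproof f)).

HB.instance Definition _ := gen_eqMixin (cremona k n).
HB.instance Definition _ := gen_choiceMixin (cremona k n).

Lemma cremona_mulA : associative cremona_mul.
Proof. by move=> f g h; apply: cremona_ext. Qed.

Lemma cremona_mul1 : left_id cremona_one cremona_mul.
Proof. by move=> f; apply: cremona_ext. Qed.

Lemma cremona_mulr1 : right_id cremona_one cremona_mul.
Proof. by move=> f; apply: cremona_ext. Qed.

Lemma cremona_mulV : left_inverse cremona_one cremona_inv cremona_mul.
Proof.
by move=> f; apply: cremona_ext => x /=; rewrite /cremona_inv; case: cid => h [] /=.
Qed.

Lemma cremona_mulVr : right_inverse cremona_one cremona_inv cremona_mul.
Proof.
by move=> f; apply: cremona_ext => x /=; rewrite /cremona_inv; case: cid => h [] /=.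
Qed.

HB.instance Definition _ := isGroup.Build (cremona k n)
  cremona_mulA cremona_mul1 cremona_mulr1 cremona_mulV cremona_mulVr.

End CremonaGroup.

Definition embeds_in_cremona (k : fieldType) (n : nat) (G : finGroupType) : Prop :=
  exists f : {multiplicative G -> cremona k n}, injective f.

(* An injective group homomorphism G -> GL_N(k); a matrix representation sends
   1 to the identity, so it takes its values in invertible matrices. *)
Definition embeds_in_GL (k : fieldType) (N : nat) (G : finGroupType) : Prop :=
  exists rG : mx_representation k [set: G]%G N, injective rG.

Lemma embeds_in_GL_exists (k : fieldType) (G : finGroupType) :
  exists N, `[< embeds_in_GL k N G >].
Proof.
exists #|[set: G]%G|; apply/asboolP; exists (regular_repr k [set: G]%G).
have := mx_faithful_inj (regular_mx_faithful k [set: G]%G).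
by move=> inj x y; apply: inj; rewrite inE.
Qed.

Definition rdim (k : fieldType) (G : finGroupType) : nat :=
  ex_minn (embeds_in_GL_exists k G).

Definition cremona_rdim_sup (R : realType) (k : fieldType) (n : nat) : \bar R :=
  ereal_sup [set x | exists2 G : finGroupType,
    embeds_in_cremona k n G & x = ((rdim k G)%:R)%:E]%classic.

(* Main.v *)
(* For u in k[x_1] and a in k let (u, a) be the automorphism x_0 -> x_0 + u(x_1),
   x_1 -> x_1 + a of k(x_0, ..., x_{n-1}).  These form a group k[x_1] ><| k, and in
   characteristic p finitely many of the (u, 0) and (0, a) lie in a finite
   p-subgroup.
   If k is finite, then GL_N(k) is finite, and the elements (x_1^i, 0) give
   arbitrarily large finite p-subgroups.
   If k is infinite, a p-subgroup of GL_N(k) is unipotent, so its commutators of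
   length N are trivial.  But commutation with (0, t) acts on the (u, 0) as the
   difference operator u(x_1) -> u(x_1 - t) - u(x_1), and for t_1, ..., t_r with
   nonzero nonempty subset sums e, the polynomial prod_e (x_1 + e) is not killed by
   the composite of the r difference operators: evaluating at 0, only one of the 2^r
   terms survives. *)
From HB Require Import structures.
Require Import Defs.
From mathcomp Require Import all_boot all_order all_algebra all_fingroup.
From mathcomp Require Import cyclic pgroup mxrepresentation mxabelem.
From mathcomp Require Import ring fraction mpoly.
From mathcomp Require Import boolp reals constructive_ereal ereal.

Set Implicit Arguments.
Unset Strict Implicit.
Unset Printing Implicit Defensive.

Import Order.TTheory GRing.Theory Num.Theory.
Local Open Scope ring_scope.

(** * Commutators and the augmentation ideal for [p]-groups in characteristic [p] *)

Section Unipotent.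
Variables (F : fieldType) (p : nat) (gT : finGroupType) (G : {group gT}).
Hypotheses (charFp : p \in [pchar F]) (pG : (p.-group G)%g).

(** A product of elements [g - 1] of the augmentation ideal, applied to a vector rather than formed
    as a matrix, so that it passes directly to quotient modules. *)
Definition aug_iter n (rG : mx_representation F G n) (v : 'rV_n) (s : seq gT) :=
  foldl (fun w g => w *m (rG g - 1%:M)) v s.

Lemma aug_iter0 n (rG : mx_representation F G n) s : aug_iter rG 0 s = 0.
Proof. by elim: s => //= g s; rewrite mul0mx. Qed.

Lemma aug_iterD n (rG : mx_representation F G n) v w s :
  aug_iter rG (v + w) s = aug_iter rG v s + aug_iter rG w s.
Proof. by elim: s v w => //= g s IHs v w; rewrite mulmxDl IHs. Qed.

Lemma in_factmod_aug_iter n (rG : mx_representation F G n) (U : 'M_n)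
    (Umod : mxmodule rG U) v s : {subset s <= G} ->
  in_factmod U (aug_iter rG v s) = aug_iter (factmod_repr Umod) (in_factmod U v) s.
Proof.
elim: s v => //= g s IHs v sG.
rewrite IHs => [|h hs]; last by apply: sG; rewrite inE hs orbT.
have Gg : g \in G by apply: sG; rewrite mem_head.
congr aug_iter; rewrite !mulmxBr !mulmx1.
by rewrite -[in_factmod U (_ - _)]/(mulmxr _ _) raddfB /= -in_factmodJ.
Qed.

(* A nontrivial p-group representation in characteristic p has a nonzero fixed
   vector, so the products get shorter by one in the quotient by fixed vectors. *)
Lemma aug_iter_eq0 n (rG : mx_representation F G n) v s :
  {subset s <= G} -> (n <= size s)%N -> aug_iter rG v s = 0.
Proof.
elim/ltn_ind: n rG v s => n IHn rG v s sG.
case: (posnP n) => [n0 _|n_gt0].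
  move: (aug_iter _ _ _) => w.
  by apply/matrixP=> i [j ltjn]; exfalso; rewrite n0 in ltjn.
case/lastP: s sG => [|s g] sG; first by rewrite leqNgt n_gt0.
rewrite size_rcons => le_n_s; rewrite /aug_iter foldl_rcons -/(aug_iter rG v s).
have fixN0 := rfix_pgroup_pchar charFp rG n_gt0 pG (subxx G).
have Umod : mxmodule rG (rfix_mx rG G) by apply: rfix_mx_module.
have: (aug_iter rG v s <= rfix_mx rG G)%MS.
  have sG' : {subset s <= G}.
    by move=> h hs; apply: sG; rewrite mem_rcons inE hs orbT.
  rewrite -in_factmod_eq0 (in_factmod_aug_iter Umod) //; apply/eqP/IHn => //.
    by rewrite mxrank_coker ltn_subrL n_gt0 lt0n mxrank_eq0 fixN0.
  rewrite mxrank_coker -ltnS (leq_trans _ le_n_s) //.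
  by rewrite ltn_subrL n_gt0 lt0n mxrank_eq0 fixN0.
move/rfix_mxP => fixv; rewrite mulmxBr mulmx1 fixv ?subrr //.
by apply: sG; rewrite mem_rcons mem_head.
Qed.

Variables (n : nat) (rG : mx_representation F G n).

(** The vectors annihilated by the [i]-th power of the augmentation ideal, which is spanned by
    products of factors [g - 1]. *)
Definition vanish_after i (v : 'rV[F]_n) :=
  forall s, {subset s <= G} -> (i <= size s)%N -> aug_iter rG v s = 0.

Lemma vanish_afterB i v w :
  vanish_after i v -> vanish_after i w -> vanish_after i (v - w).
Proof.
move=> vv vw s sG le_is; rewrite aug_iterD vv // add0r.
by rewrite -[LHS]addr0 -{1}(vw s) // -aug_iterD addNr aug_iter0.
Qed.

Lemma vanish_after_aug i v g : g \in G ->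
  vanish_after i.+1 v -> vanish_after i (v *m (rG g - 1%:M)).
Proof.
move=> Gg vv s sG le_is; apply: (vv (g :: s)) => // h.
by rewrite inE => /predU1P[-> | /sG].
Qed.

(** Write [g = (g - 1) + 1]: an extra factor [g - 1] only lengthens the product. *)
Lemma vanish_afterJ i v g : g \in G ->
  vanish_after i v -> vanish_after i (v *m rG g).
Proof.
move=> Gg vv; rewrite -[rG g](subrK 1%:M) mulmxDr mulmx1 => s sG le_is.
rewrite aug_iterD (vv s) // addr0; apply: (vv (g :: s)); last exact: leqW.
by move=> h; rewrite inE => /predU1P[-> | /sG].
Qed.

(* The j-th step of the lower central series lies in 1 + I^j, I being the
   augmentation ideal. *)
Definition aug_depth j g :=
  forall i v, vanish_after (i + j) v -> vanish_after i (v *m (rG g - 1%:M)).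

(** This rests on the identity [[g, h] - 1 = g^-1 h^-1 ((g - 1)(h - 1) - (h - 1)(g - 1))]: in both
    products [g - 1] accounts for [j] steps of the filtration and [h - 1] for one more. *)
Lemma aug_depth_commg j g h : g \in G -> h \in G ->
  aug_depth j g -> aug_depth j.+1 [~ g, h]%g.
Proof.
move=> Gg Gh dg i v vv.
have -> : v *m (rG [~ g, h]%g - 1%:M) =
    v *m rG g^-1%g *m rG h^-1%g *m (rG g - 1%:M) *m (rG h - 1%:M)
    - v *m rG g^-1%g *m rG h^-1%g *m (rG h - 1%:M) *m (rG g - 1%:M).
  set u := v *m _ *m _.
  have -> : v *m (rG [~ g, h]%g - 1%:M) = u *m (rG g *m rG h - rG h *m rG g).
    rewrite /u mulmxBr -!mulmxA -!repr_mxM ?groupM ?groupV //.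
    rewrite !mulmxBr -!repr_mxM ?groupM ?groupV //.
    by rewrite mulKg mulVg repr_mx1.
  rewrite -!(mulmxA u) -mulmxBr; congr (u *m _).
  rewrite !mulmxBl !mulmxBr !mul1mx !mulmx1; apply/eqP; rewrite -subr_eq0.
  by apply/eqP/matrixP => a b; rewrite !mxE; ring.
have vu : vanish_after (i + j.+1) (v *m rG g^-1%g *m rG h^-1%g).
  by do 2![apply: vanish_afterJ; rewrite ?groupV //].
apply: vanish_afterB.
  by apply: vanish_after_aug => //; apply: dg; rewrite addSn -addnS.
by apply: dg; apply: vanish_after_aug => //; rewrite -addnS.
Qed.

Lemma aug_depth_iter_commg j g hs : g \in G -> {subset hs <= G} ->
  aug_depth j g -> aug_depth (j + size hs) (foldl commg g hs).
Proof.
elim: hs g j => [|h hs IHhs] g j Gg hsG dg /=; first by rewrite addn0.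
have Gh : h \in G by apply: hsG; rewrite mem_head.
rewrite addnS -addSn; apply: IHhs; first by rewrite groupR.
  by move=> x xhs; apply: hsG; rewrite inE xhs orbT.
exact: aug_depth_commg.
Qed.

(** The iterated commutator has depth [(size hs).+1], and by [aug_iter_eq0] any product of at least
    [n] factors [g - 1] kills every vector. *)
Lemma iter_commg_repr g hs : g \in G -> {subset hs <= G} -> (n <= (size hs).+1)%N ->
  rG (foldl commg g hs) = 1%:M.
Proof.
move=> Gg hsG le_n.
suff d : aug_depth (size hs).+1 (foldl commg g hs).
  apply/row_matrixP => a; apply/eqP; rewrite -subr_eq0 !rowE -mulmxBr.
  (* [vanish_after 0], tested on the empty sequence, says that the vector itself is zero. *)
  apply/eqP; apply: (d 0%N _ _ [::]) => // s sG le_s.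
  by apply: aug_iter_eq0 => //; apply: leq_trans le_s.
have d1 : aug_depth 1 g.
  by move=> i v vv; apply: vanish_after_aug => //; rewrite -addn1.
rewrite -add1n; apply: aug_depth_iter_commg d1 => //.
Qed.

End Unipotent.

(** * The translation action on polynomials *)

Section Translate.
Variable R : comNzRingType.

Definition translate (a : R) (u : {poly R}) := u \Po ('X + a%:P).

Lemma translateE a u x : (translate a u).[x] = u.[x + a].
Proof. by rewrite /translate horner_comp !hornerE. Qed.

Lemma translate0 u : translate 0 u = u.
Proof. by rewrite /translate addr0 comp_polyXr. Qed.

Lemma translateD a b u : translate a (translate b u) = translate (a + b) u.
Proof.
rewrite /translate -comp_polyA !comp_polyD comp_polyX comp_polyC.
by rewrite polyCD addrA.
Qed.

Lemma translate_is_linear a : linear (translate a).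
Proof. by move=> c u v; rewrite /translate linearP. Qed.

HB.instance Definition _ a :=
  GRing.isLinear.Build R {poly R} {poly R} *:%R (translate a)
    (translate_is_linear a).

End Translate.

(** * Finite additive spans in a group killed by [p] *)

Section FinSpan.
Variables (p : nat) (M : zmodType).
Hypothesis p_gt0 : (0 < p)%N.
Hypothesis Mp : forall x : M, x *+ p = 0.

(** An explicit list, because the ambient group need not be finite; coefficients below [p] suffice
    since [p] kills [M]. *)
Definition span_seq (s : seq M) : seq M :=
  foldr (fun x t => [seq x *+ i + y | i <- iota 0 p, y <- t]) [:: 0] s.

Lemma span_seq_cons x s z :
  reflect (exists2 i, (i < p)%N & exists2 y, y \in span_seq s & z = x *+ i + y)
    (z \in span_seq (x :: s)).
Proof.
apply: (iffP allpairsP) => [[[i y] [/= ip ys ->]]|[i ip [y ys ->]]].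
  by exists i; [move: ip; rewrite mem_iota | exists y].
by exists (i, y); rewrite mem_iota.
Qed.

Lemma mem0_span_seq s : 0 \in span_seq s.
Proof.
elim: s => [|x s IHs]; first by rewrite inE.
by apply/span_seq_cons; exists 0%N => //; exists 0 => //; rewrite addr0.
Qed.

Lemma span_seqD s : {in span_seq s &, forall x y, x + y \in span_seq s}.
Proof.
elim: s => [|x s IHs] y z; first by rewrite !inE => /eqP-> /eqP->; rewrite addr0.
move=> /span_seq_cons[i ip [y' sy' ->]] /span_seq_cons[j jp [z' sz' ->]].
apply/span_seq_cons; exists ((i + j) %% p)%N; first by rewrite ltn_mod.
exists (y' + z'); first exact: IHs.
rewrite addrACA -mulrnDr {1}(divn_eq (i + j) p) mulrnDr mulnC mulrnA Mp.
by rewrite mul0rn add0r.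
Qed.

Lemma span_seqMn s x i : x \in span_seq s -> x *+ i \in span_seq s.
Proof.
by move=> sx; elim: i => [|i IHi]; rewrite ?mem0_span_seq // mulrS span_seqD.
Qed.

Lemma span_seqN s x : x \in span_seq s -> - x \in span_seq s.
Proof.
move=> sx; have -> : - x = x *+ p.-1; last exact: span_seqMn.
by apply/esym/eqP; rewrite -addr_eq0 -mulrSr prednK ?Mp.
Qed.

Lemma sub_span_seq s : {subset s <= span_seq s}.
Proof.
elim: s => //= x s IHs y; rewrite inE => ys; apply/span_seq_cons.
case/predU1P: ys => [-> | /IHs ys]; last first.
  by exists 0%N => //; exists y; rewrite ?add0r.
(* The coefficient [1] is available only if [1 < p]; for [p = 1] the hypothesis [Mp] makes [M]
   trivial. *)
have [p1|p1] := leqP p 1.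
  have p_eq1 : p = 1%N by apply/eqP; rewrite eqn_leq p1.
  have -> : x = 0 by rewrite -(Mp x) p_eq1.
  by exists 0%N => //; exists 0; rewrite ?mem0_span_seq ?addr0.
by exists 1%N => //; exists 0; rewrite ?mem0_span_seq ?addr0.
Qed.

Lemma span_seq_sub s (S : {pred M}) : 0 \in S -> {in S &, forall x y, x + y \in S} ->
  {subset s <= S} -> {subset span_seq s <= S}.
Proof.
move=> S0 SD; elim: s => [_ y|x s IHs sS y]; first by rewrite inE => /eqP->.
case/span_seq_cons => i _ [z sz ->]; apply: (SD); last first.
  by apply: IHs sz => u us; apply: sS; rewrite inE us orbT.
elim: i => [|i IHi]; first by rewrite mulr0n.
by rewrite mulrS; apply: SD => //; apply: sS; rewrite mem_head.
Qed.

End FinSpan.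

(** * Iterated differences of polynomials *)

Section IterDiff.
Variable k : fieldType.

(** The sign of [a] is the one produced by the commutator in [elem_cremonaR]. *)
Definition diff_translate (u : {poly k}) a := translate (- a) u - u.

Definition subset_sums : seq k -> seq k :=
  foldr (fun t s => t :: s ++ [seq t + e | e <- s]) [::].

(* Expanding the iterated difference at 0 gives f(0), up to sign, plus values of
   f at the opposites of the nonempty subset sums. *)
Lemma iter_diff_translate_horner ts (f : {poly k}) x :
  f.[x] != 0 -> {in subset_sums ts, forall e, f.[x - e] = 0} ->
  (foldl diff_translate f ts).[x] != 0.
Proof.
elim: ts f => //= t ts IHts f fx fE; apply: IHts => [|e ets].
  by rewrite hornerD hornerN translateE fE ?mem_head // add0r oppr_eq0.
rewrite hornerD hornerN translateE -addrA -opprD [e + t]addrC.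
rewrite !fE ?subrr // inE mem_cat ?ets ?orbT //.
by rewrite map_f ?orbT.
Qed.

Lemma exists_subset_sums_neq0 r : (forall s : seq k, exists x, x \notin s) ->
  exists2 ts, size ts = r & 0 \notin subset_sums ts.
Proof.
move=> k_inf; elim: r => [|r [ts size_ts ts0]]; first by exists [::].
(* The new subset sums are [t] and the [t + e]; the listed values are exactly those for which one of
   them is zero. *)
have [t] := k_inf (0 :: [seq - e | e <- subset_sums ts]).
rewrite inE negb_or => /andP[t0 tE]; exists (t :: ts); first by rewrite /= size_ts.
rewrite /= inE mem_cat !negb_or eq_sym t0 ts0 /=.
apply: contra tE => /mapP[e ets /esym/eqP]; rewrite addr_eq0 => /eqP->.
exact: map_f.
Qed.

Lemma exists_iter_diff_neq0 r : (forall s : seq k, exists x, x \notin s) ->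
  exists f ts, size ts = r /\ foldl diff_translate f ts != 0.
Proof.
move=> /(exists_subset_sums_neq0 r)[ts size_ts ts0].
pose f := \prod_(e <- subset_sums ts) ('X + e%:P) : {poly k}.
exists f, ts; split=> //.
suff: (foldl diff_translate f ts).[0] != 0.
  by apply: contraNneq => ->; rewrite horner0.
apply: iter_diff_translate_horner => [|e ets].
  rewrite horner_prod prodf_seq_neq0; apply/allP => e ets /=.
  by rewrite !hornerE; apply: contraNneq ts0 => <-.
apply/eqP; rewrite horner_prod prodf_seq_eq0; apply/hasP; exists e => //=.
by rewrite !hornerE addNr.
Qed.

End IterDiff.

(** * Extension of injective ring morphisms to fraction fields *)

Lemma frac_numden (A : idomainType) (x : {fraction A}) :
  x = tofrac \n_(generic_quotient.repr x) / tofrac \d_(generic_quotient.repr x).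
Proof.
set r := generic_quotient.repr x.
have dN0 : (tofrac \d_r : {fraction A}) != 0 by rewrite tofrac_eq0 denom_ratioP.
apply: (mulIf dN0); rewrite divfK // -[in LHS](generic_quotient.reprK x) -/r.
unlock FracField.tofrac; rewrite -[LHS]FracField.pi_mul.
apply/generic_quotient.eqmodP; rewrite /= /FracField.equivf /FracField.mulf.
rewrite !numden_Ratio ?mulf_neq0 ?denom_ratioP ?oner_neq0 //.
by rewrite !mulr1 mulrC.
Qed.

Lemma fracP (A : idomainType) (x : {fraction A}) :
  exists a b, b != 0 /\ x = tofrac a / tofrac b.
Proof. by do 2!eexists; split; last exact: frac_numden; apply: denom_ratioP. Qed.

Section FracMap.
Variables (A B : idomainType) (f : {rmorphism A -> B}).
Hypothesis f_inj : injective f.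

(** Taking the injectivity proof as an argument lets the morphism structures be attached to
    [frac_map f_inj]. The value is computed on chosen representatives; [frac_mapE] shows that any
    others give the same. *)
Definition frac_map of injective f := fun x : {fraction A} =>
  tofrac (f \n_(generic_quotient.repr x))
  / tofrac (f \d_(generic_quotient.repr x)) : {fraction B}.

Lemma tofrac_map_eq0 (a : A) : (tofrac (f a) == 0 :> {fraction B}) = (a == 0).
Proof. by rewrite tofrac_eq0 -(rmorph0 f) (inj_eq f_inj). Qed.

(** Cross-multiplication reduces the equality to an identity in [A], because [f] is injective and
    multiplicative. *)
Lemma frac_mapE a b : b != 0 ->
  frac_map f_inj (tofrac a / tofrac b) = tofrac (f a) / tofrac (f b).
Proof.
move=> b0; rewrite /frac_map; set r := generic_quotient.repr _.
have d0 : \d_r != 0 by apply: denom_ratioP.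
apply/eqP; rewrite eqr_div ?tofrac_map_eq0 // -!rmorphM /= tofrac_eq (inj_eq f_inj).
rewrite -tofrac_eq !rmorphM /= -eqr_div ?tofrac_eq0 //.
by apply/eqP; rewrite -frac_numden.
Qed.

Lemma frac_map_tofrac a : frac_map f_inj (tofrac a) = tofrac (f a).
Proof.
rewrite -[tofrac a]divr1 -(rmorph1 (@tofrac A)) frac_mapE ?oner_eq0 //.
by rewrite !rmorph1 divr1.
Qed.

Lemma frac_map_is_zmod_morphism : zmod_morphism (frac_map f_inj).
Proof.
move=> x y; have [a [b [b0 ->]]] := fracP x; have [c [d [d0 ->]]] := fracP y.
have tb : (tofrac b : {fraction A}) != 0 by rewrite tofrac_eq0.
have td : (tofrac d : {fraction A}) != 0 by rewrite tofrac_eq0.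
rewrite -mulNr addf_div // -rmorphN -!rmorphM -rmorphD /= !frac_mapE ?mulf_neq0 //.
by rewrite -mulNr addf_div ?tofrac_map_eq0 // !(rmorphD, rmorphM, rmorphN) /=.
Qed.

Lemma frac_map_is_monoid_morphism : monoid_morphism (frac_map f_inj).
Proof.
split; first by rewrite -(rmorph1 (@tofrac A)) frac_map_tofrac !rmorph1.
move=> x y; have [a [b [b0 ->]]] := fracP x; have [c [d [d0 ->]]] := fracP y.
by rewrite mulf_div -!rmorphM /= !frac_mapE ?mulf_neq0 // mulf_div !rmorphM.
Qed.

HB.instance Definition _ :=
  GRing.isZmodMorphism.Build _ _ (frac_map f_inj) frac_map_is_zmod_morphism.
HB.instance Definition _ :=
  GRing.isMonoidMorphism.Build _ _ (frac_map f_inj) frac_map_is_monoid_morphism.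

End FracMap.

Lemma frac_mapK (A B : idomainType) (f : {rmorphism A -> B}) (g : {rmorphism B -> A})
  (f_inj : injective f) (g_inj : injective g) : cancel f g ->
  cancel (frac_map f_inj) (frac_map g_inj).
Proof.
move=> fgK x; have [a [b [b0 ->]]] := fracP x.
by rewrite !frac_mapE ?fgK //; rewrite -(rmorph0 f) (inj_eq f_inj).
Qed.

(** * Elementary automorphisms of the rational function field *)

Section Elementary.
Variables (k : fieldType) (n : nat) (i0 i1 : 'I_n).
Hypothesis i01 : i0 != i1.
Implicit Types (u w : {poly k}) (a b : k).

Lemma mpoly_rmorph_eq (S : comNzRingType) (f g : {rmorphism {mpoly k[n]} -> S}) :
  (forall c, f c%:MP = g c%:MP) -> (forall i, f 'X_i = g 'X_i) -> f =1 g.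
Proof.
move=> fgC fgX q; rewrite (mpolyE q) !rmorph_sum; apply: eq_bigr => m _.
rewrite -mul_mpolyC !rmorphM fgC; congr (_ * _).
rewrite mpolyXE_id !rmorph_prod; apply: eq_bigr => i _.
by rewrite !rmorphXn fgX.
Qed.

Definition polyX1 u : {mpoly k[n]} := (map_poly (@mpolyC n k) u).['X_i1].

Lemma polyX1D u w : polyX1 (u + w) = polyX1 u + polyX1 w.
Proof. by rewrite /polyX1 rmorphD hornerD. Qed.

Lemma polyX1_inj : injective polyX1.
Proof.
(* Sending every variable to ['X] gives a left inverse. *)
apply: (can_inj (g := mmap (@polyC k) (fun=> 'X))) => u.
rewrite /polyX1 -horner_map -map_poly_comp /= mmapX mmap1U.
rewrite -[RHS]comp_polyXr /comp_poly; congr (_.[_]).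
by apply: eq_map_poly => c /=; rewrite mmapC.
Qed.

Definition elem_tuple u a : n.-tuple {mpoly k[n]} :=
  [tuple if i == i0 then 'X_i0 + polyX1 u
         else if i == i1 then 'X_i1 + a%:MP else 'X_i | i < n].

Definition elem_map u a : {rmorphism {mpoly k[n]} -> {mpoly k[n]}} :=
  comp_mpoly (elem_tuple u a).

Lemma elem_mapC u a c : elem_map u a c%:MP = c%:MP.
Proof. exact: comp_mpolyC. Qed.

Lemma elem_mapX u a i : elem_map u a 'X_i =
  if i == i0 then 'X_i0 + polyX1 u else if i == i1 then 'X_i1 + a%:MP else 'X_i.
Proof. by rewrite /= comp_mpolyXU -tnth_nth tnth_mktuple. Qed.

Lemma elem_map_polyX1 u a w : elem_map u a (polyX1 w) = polyX1 (translate a w).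
Proof.
rewrite /polyX1 -horner_map elem_mapX eq_sym (negPf i01) eqxx -map_poly_comp /=.
rewrite /translate map_comp_poly horner_comp rmorphD /= map_polyX map_polyC /=.
rewrite !hornerE.
by congr (_.[_]); apply: eq_map_poly => c; rewrite /= comp_mpolyC.
Qed.

(** This is the semidirect product law: the outer map shifts the variable ['X_i1] inside [polyX1 w],
    whence the twist by [translate a]. *)
Lemma elem_mapM u a w b :
  elem_map u a \o elem_map w b =1 elem_map (u + translate a w) (a + b).
Proof.
apply: mpoly_rmorph_eq => [c|i].
  by rewrite ![in RHS]elem_mapC [LHS]/= !comp_mpolyC.
transitivity (elem_map u a (elem_map w b 'X_i)) => //.
rewrite [elem_map w b _]elem_mapX elem_mapX.
have [_ | ii0] := eqVneq i i0.
  by rewrite [LHS]rmorphD elem_map_polyX1 elem_mapX eqxx -addrA polyX1D.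
have [_ | ii1] := eqVneq i i1.
  rewrite [LHS]rmorphD elem_mapC elem_mapX eq_sym (negPf i01) eqxx.
  by rewrite mpolyCD addrA.
by rewrite elem_mapX (negPf ii0) (negPf ii1).
Qed.

Lemma elem_map0 : elem_map 0 0 =1 id.
Proof.
apply: (mpoly_rmorph_eq (g := idfun)) => [c|i]; first exact: elem_mapC.
rewrite elem_mapX /polyX1 rmorph0 horner0 mpolyC0 !addr0 /=.
by case: eqP => [->|_] //; case: eqP => [->|_].
Qed.

Lemma elem_mapK u a : cancel (elem_map u a) (elem_map (- translate (- a) u) (- a)).
Proof.
move=> q; have /= -> := elem_mapM _ (- a) u a q.
by rewrite addNr addNr; apply: elem_map0.
Qed.

Lemma elem_mapVK u a : cancel (elem_map (- translate (- a) u) (- a)) (elem_map u a).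
Proof.
move=> q; have /= -> := elem_mapM u a _ (- a) q.
rewrite subrr raddfN /= translateD subrr translate0.
by rewrite subrr; apply: elem_map0.
Qed.

Definition elem_frac u a : {rmorphism ratfun k n -> ratfun k n} :=
  frac_map (can_inj (elem_mapK u a)).

Lemma elem_frac_bij u a : bijective (elem_frac u a).
Proof.
exists (elem_frac (- translate (- a) u) (- a)); apply: frac_mapK.
  exact: elem_mapK.
exact: elem_mapVK.
Qed.

Lemma elem_fracE u a q : elem_frac u a (tofrac q) = tofrac (elem_map u a q).
Proof. exact: frac_map_tofrac. Qed.

Lemma elem_frac_const u a c : elem_frac u a (ratconst n c) = ratconst n c.
Proof. by rewrite elem_fracE elem_mapC. Qed.

Definition elem_cremona u a : cremona k n :=
  Cremona (elem_frac_bij u a) (elem_frac_const u a).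

Lemma elem_frac_div u a q r : r != 0 ->
  elem_frac u a (tofrac q / tofrac r) =
  tofrac (elem_map u a q) / tofrac (elem_map u a r).
Proof. exact: frac_mapE. Qed.

Lemma elem_fracM u a w b x :
  elem_frac u a (elem_frac w b x) = elem_frac (u + translate a w) (a + b) x.
Proof.
have [q [r [r0 ->]]] := fracP x.
have wr0 : elem_map w b r != 0.
  by rewrite -(rmorph0 (elem_map w b)) (inj_eq (can_inj (elem_mapK w b))).
rewrite (elem_frac_div w b q r0) (elem_frac_div u a _ wr0) (elem_frac_div _ _ q r0).
by rewrite -!(elem_mapM u a w b).
Qed.

Lemma elem_cremonaM u a w b :
  (elem_cremona u a * elem_cremona w b)%g =
  elem_cremona (u + translate a w) (a + b).
Proof. by apply: cremona_ext => x; apply: elem_fracM. Qed.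

Lemma elem_cremona_inj u a w b :
  elem_cremona u a = elem_cremona w b -> u = w /\ a = b.
Proof.
move=> e; have eX i : elem_map u a 'X_i = elem_map w b 'X_i.
  apply/eqP; rewrite -tofrac_eq -!elem_fracE; apply/eqP.
  exact: (congr1 (fun f : cremona k n => f (tofrac 'X_i)) e).
move: (eX i0) (eX i1); rewrite !elem_mapX eqxx [i1 == i0]eq_sym (negPf i01) eqxx.
by move=> /addrI/polyX1_inj -> /addrI/eqP; rewrite mpolyC_eq => /eqP ->.
Qed.

End Elementary.

(** * Finite [p]-subgroups of the Cremona group *)

Lemma seq_finGroup (T : groupType) (s : seq T) :
  (1 \in s)%g -> {in s &, forall x y, x * y \in s}%g ->
  {in s, forall x, x^-1 \in s}%g ->
  exists (G : finGroupType) (f : UMagmaMorphism.type G T),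
    injective f /\ forall x, x \in s <-> exists g, f g = x.
Proof.
(* The carrier is the finite type of members of [s], as [T] itself need not be finite. *)
move=> s1 sM sV; pose S := seq_sub s.
pose mul (x y : S) : S := SeqSub (sM _ _ (ssvalP x) (ssvalP y)).
pose inv (x : S) : S := SeqSub (sV _ (ssvalP x)).
pose one : S := SeqSub s1.
have mulA : associative mul by move=> x y z; apply: val_inj; rewrite /= mulgA.
have mul1 : left_id one mul by move=> x; apply: val_inj; rewrite /= mul1g.
have mulV : left_inverse one inv mul by move=> x; apply: val_inj; rewrite /= mulVg.
pose G : finGroupType := HB.pack S (Finite_isGroup.Build S mulA mul1 mulV).
pose v : G -> T := @ssval T s.
have v1 : v 1%g = 1%g by [].
have vM : {morph v : x y / (x * y)%g} by [].
pose f : UMagmaMorphism.type G T :=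
  HB.pack v (isMultiplicative.Build G T v vM)
    (Multiplicative_isUMagmaMorphism.Build G T v v1).
exists G, f; split=> [|x]; first exact: val_inj.
by split=> [sx | [g <-]]; [exists (SeqSub sx) | apply: ssvalP].
Qed.

Section Construction.
Variables (k : fieldType) (p : nat) (charkp : p \in [pchar k]).
Variables (n : nat) (i0 i1 : 'I_n) (i01 : i0 != i1).

Local Notation elem := (@elem_cremona k n i0 i1 i01).

Lemma elem_cremona1 : elem 0 0 = 1%g.
Proof.
by apply: (mulgI (elem 0 0)); rewrite elem_cremonaM raddf0 !addr0 mulg1.
Qed.

Lemma elem_cremonaV u a : (elem u a)^-1%g = elem (- translate (- a) u) (- a).
Proof.
apply: (mulgI (elem u a)); rewrite mulgV elem_cremonaM raddfN /= translateD.
by rewrite !subrr translate0 subrr elem_cremona1.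
Qed.

Lemma elem_cremonaR u a : [~ elem u 0, elem 0 a]%g = elem (diff_translate u a) 0.
Proof.
rewrite /commg /conjg !elem_cremonaV !elem_cremonaM !raddf0 ?oppr0 !translate0 /=.
by rewrite !add0r !addr0 addNr /diff_translate addrC.
Qed.

Lemma iter_elem_cremonaR u ts :
  foldl commg (elem u 0) [seq elem 0 t | t <- ts] =
  elem (foldl (@diff_translate k) u ts) 0.
Proof. by elim: ts u => //= t ts IHts u; rewrite elem_cremonaR IHts. Qed.

(** Only the second coordinate matters: it vanishes for [m = p], leaving an element [elem w 0],
    whose own powers [elem_cremonaX0] computes. *)
Lemma elem_cremonaX u a m : exists w, (elem u a ^+ m)%g = elem w (a *+ m).
Proof.
elim: m => [|m [w IHm]]; first by exists 0; rewrite expg0 elem_cremona1.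
by exists (u + translate a w); rewrite expgS IHm elem_cremonaM mulrS.
Qed.

Lemma elem_cremonaX0 u m : (elem u 0 ^+ m)%g = elem (u *+ m) 0.
Proof.
elim: m => [|m IHm]; first by rewrite expg0 elem_cremona1.
by rewrite expgS IHm elem_cremonaM translate0 addr0 mulrS.
Qed.

Lemma exists_elem_pgroup (F : seq {poly k}) (ts : seq k) :
  exists (G : finGroupType) (f : UMagmaMorphism.type G (cremona k n)),
  [/\ injective f, (p.-group [set: G])%g,
      {in F, forall u, exists g, f g = elem u 0}
    & {in ts, forall t, exists g, f g = elem 0 t}].
Proof.
have p_pr : prime p by case/andP: charkp.
have p_gt0 := prime_gt0 p_pr.
have kp (x : k) : x *+ p = 0 by rewrite (mulrn_pchar charkp).
have kXp (u : {poly k}) : u *+ p = 0.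
  by apply/polyP=> i; rewrite coefMn coef0 kp.
(* Spanning all [A]-translates of [F] makes [V] stable under translation by [A], so that the pairs
   form a finite group [V ><| A]. *)
pose A := span_seq p ts; pose V := span_seq p [seq translate a u | a <- A, u <- F].
have A0 : 0 \in A by apply: mem0_span_seq.
have AD : {in A &, forall x y, x + y \in A} by apply: span_seqD.
have V0 : 0 \in V by apply: mem0_span_seq.
have VD : {in V &, forall x y, x + y \in V} by apply: span_seqD.
have VA a u : a \in A -> u \in V -> translate a u \in V.
  move=> Aa; apply: (span_seq_sub (S := [pred u | translate a u \in V])).
  - by rewrite inE raddf0.
  - by move=> x y; rewrite !inE raddfD; apply: VD.
  move=> _ /allpairsP[[b w] [/= Ab Fw ->]]; rewrite inE translateD.
  apply: sub_span_seq => //; apply/allpairsP; exists (a + b, w); split=> //=.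
  exact: AD.
pose s := [seq elem u a | u <- V, a <- A].
have sP x : reflect (exists u a, [/\ u \in V, a \in A & x = elem u a]) (x \in s).
  apply: (iffP allpairsP) => [[[u a] [/= ? ? ->]] | [u [a [? ? ->]]]].
    by exists u, a.
  by exists (u, a).
have s1 : (1 \in s)%g by apply/sP; exists 0, 0; rewrite elem_cremona1.
have sM : {in s &, forall x y, x * y \in s}%g.
  move=> x y /sP[u [a [Vu Aa ->]]] /sP[w [b [Vw Ab ->]]]; rewrite elem_cremonaM.
  by apply/sP; exists (u + translate a w), (a + b); rewrite VD ?VA ?AD.
have sV : {in s, forall x, x^-1 \in s}%g.
  move=> x /sP[u [a [Vu Aa ->]]]; rewrite elem_cremonaV.
  apply/sP; exists (- translate (- a) u), (- a); split=> //; last exact: span_seqN.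
  by apply: span_seqN => //; apply: VA => //; apply: span_seqN.
have [G [f [f_inj fs]]] := seq_finGroup s1 sM sV.
exists G, f; split=> // [|u Fu|t tst].
(* By Cauchy a prime divisor [q] of the order is the order of some [g]; since [g ^+ (p * p) = 1], it
   must be [p]. *)
- apply/pgroupP => q q_pr q_dvd; have [g _ g_q] := Cauchy q_pr q_dvd.
  have /sP[u [a [_ _ fg]]] : f g \in s by apply/fs; exists g.
  have : (g ^+ (p * p) = 1)%g.
    apply: f_inj; rewrite gmulfXn gmulf1 fg expgM.
    have [w ->] := elem_cremonaX u a p.
    by rewrite kp elem_cremonaX0 kXp elem_cremona1.
  by move/eqP; rewrite -order_dvdn g_q Euclid_dvdM // orbb dvdn_prime2.
- apply/fs/sP; exists u, 0; split=> //; apply: sub_span_seq => //.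
  by apply/allpairsP; exists (0, u); rewrite /= translate0.
- by apply/fs/sP; exists 0, t; split=> //; apply: sub_span_seq.
Qed.

(** * Unbounded representation dimension over finite and infinite fields *)

Lemma finite_field_unbounded_dim N : (exists s : seq k, forall x, x \in s) ->
  exists G, embeds_in_cremona k n G /\ forall M, (M < N)%N -> ~ embeds_in_GL k M G.
Proof.
(* [c] is the cardinality of [k], so [m] exceeds the number of [M] by [M] matrices for every
   [M < N]. *)
case=> s k_s; pose c := #|{: seq_sub s}|; pose m := (c ^ (N * N)).+1.
have c_gt0 : (0 < c)%N by apply/card_gt0P; exists (SeqSub (k_s 0)).
have [G [f [f_inj _ fX _]]] := exists_elem_pgroup [seq 'X^i | i <- iota 0 m] [::].
exists G; split; first by exists f.
move=> M ltMN [rG rG_inj].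
have le_mG : (m <= #|G|)%N.
  have /fin_all_exists[h hE] (i : 'I_m) : exists g, f g = elem 'X^i 0.
    by apply: fX; apply: map_f; rewrite mem_iota /=.
  rewrite -[m]card_ord; apply: (leq_card h) => i j hij.
  have /(elem_cremona_inj (i01 := i01))[eX _] : elem 'X^i 0 = elem 'X^j 0.
    by rewrite -!hE hij.
  have := congr1 (fun u : {poly k} => size u) eX.
  by rewrite !size_polyXn => -[] /val_inj.
pose h (g : G) : {ffun 'I_M * 'I_M -> seq_sub s} :=
  [ffun ij => SeqSub (k_s (rG g ij.1 ij.2))].
have h_inj : injective h.
  move=> g g' /ffunP hgg'; apply: rG_inj; apply/matrixP => i j.
  by move: (hgg' (i, j)); rewrite !ffunE => /(congr1 val).
have := leq_trans le_mG (leq_card h h_inj).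
rewrite card_ffun card_prod card_ord -/c ltnNge => /negP; apply.
by rewrite leq_pexp2l // leq_mul // ltnW.
Qed.

Lemma infinite_field_unbounded_dim N : (forall s : seq k, exists x, x \notin s) ->
  exists G, embeds_in_cremona k n G /\ forall M, (M < N)%N -> ~ embeds_in_GL k M G.
Proof.
move=> /(exists_iter_diff_neq0 N)[u [ts [size_ts u_ts]]].
have [G [f [f_inj pG fF fts]]] := exists_elem_pgroup [:: u] ts.
exists G; split; first by exists f.
move=> M ltMN [rG rG_inj].
have [g fg] := fF u (mem_head _ _).
have [hs fhs] : exists hs, [seq f h | h <- hs] = [seq elem 0 t | t <- ts].
  elim: ts fts {size_ts u_ts} => [|t ts IHts] fts; first by exists [::].
  have [h fh] := fts t (mem_head _ _).
  have [|hs fhs] := IHts; first by move=> x tsx; apply: fts; rewrite inE tsx orbT.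
  by exists (h :: hs); rewrite /= fh fhs.
(* The [N] commutations outnumber the dimension [M], so the matrix is trivial, and faithfulness
   carries this back to [G]. *)
have: foldl commg g hs = 1%g.
  apply: rG_inj; rewrite (iter_commg_repr charkp pG) ?repr_mx1 ?inE //.
  by rewrite -(size_map f) fhs size_map size_ts (leq_trans (ltnW ltMN)).
have f_foldl g' : f (foldl commg g' hs) = foldl commg (f g') [seq f h | h <- hs].
  by elim: hs g' {fhs} => //= h hs IHhs g'; rewrite IHhs gmulfR.
(* In the Cremona group the same commutator is the iterated difference of [u], which is nonzero by
   the choice of [u] and [ts]. *)
move/(congr1 f); rewrite f_foldl fg fhs iter_elem_cremonaR gmulf1 -elem_cremona1.
by case/(elem_cremona_inj (i01 := i01)) => /eqP; rewrite (negPf u_ts).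
Qed.

End Construction.

Lemma rdim_ge (k : fieldType) (G : finGroupType) N :
  (forall M, (M < N)%N -> ~ embeds_in_GL k M G) -> (N <= rdim k G)%N.
Proof.
move=> H; rewrite /rdim; case: ex_minnP => M /asboolP GM _.
by rewrite leqNgt; apply/negP => /H.
Qed.

Theorem theorem1p3 (R : realType) (k : fieldType) (p : nat)
    (char_k : p \in [pchar k]%R) (n : nat) (hn : (2 <= n)%N) :
  cremona_rdim_sup R k n = (+oo)%E.
Proof.
(* The bound [2 <= n] supplies two distinct variables. *)
pose i0 := Ordinal (ltnW hn); pose i1 := Ordinal hn.
have i01 : i0 != i1 by [].
have unbounded N : ((N%:R)%:E <= cremona_rdim_sup R k n)%E.
  have [G [GCr /rdim_ge le_N]] :
      exists G, embeds_in_cremona k n G /\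
        forall M, (M < N)%N -> ~ embeds_in_GL k M G.
    have [k_fin | k_inf] := pselect (exists s : seq k, forall x, x \in s).
      exact: (finite_field_unbounded_dim char_k i01 N k_fin).
    apply: (infinite_field_unbounded_dim char_k i01) => s.
    apply: contrapT => /forallNP s_all; apply: k_inf; exists s => x.
    exact/negPn/negP/s_all.
  apply: (@le_trans _ _ ((rdim k G)%:R)%:E); first by rewrite lee_fin ler_nat.
  by apply: ereal_sup_ubound; exists G.
case: (cremona_rdim_sup R k n) unbounded => [r| |] // unbounded; last first.
  by have := unbounded 0%N.
(* A finite supremum [r] would lie strictly below the natural number [(Num.trunc r).+1]. *)
have := unbounded (Num.trunc r).+1; rewrite lee_fin leNgt => /negP[].
exact: truncnS_gt.
Qed.
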